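(* Let $p$ be a prime, let $G$ be a finite $p$-solvable group, let $k$ be a field of characteristic $p$, and let $V$ be a finite-dimensional absolutely irreducible $kG$-module, with representation $\rho: G \to \mathrm{GL}(V)$. If $p$ does not divide $\dim_k V$, then $(G,V)$ is weakly adequate, i.e. $\mathrm{End}_k(V)$ is spanned (as a $k$-vector space) by the elements $\rho(g)$, $g \in G$, for which $\rho(g)$ is semisimple.
   Context: A finite group is $p$-solvable if every composition factor has order $p$ or order prime to $p$. For a representation $\rho: G \to \mathrm{GL}(V)$, the pair $(G,V)$ is called weakly adequate if $\mathrm{End}_k(V)$ is spanned by the set $\{\rho(g) : g \in G,\ \rho(g) \text{ semisimple}\}$. *)

(* Defs.v *)
From HB Require Import structures.
From mathcomp Require Import all_boot all_order all_algebra all_fingroup all_solvable all_field all_character.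
From mathcomp Require Import boolp.
Set Implicit Arguments. Unset Strict Implicit. Unset Printing Implicit Defensive.
Import GRing.Theory.
Local Open Scope ring_scope.

(* p-solvable: every composition factor of G has order p or order prime to p.
   For a composition series s = [:: G_1; ...; 1] of G (comps G s), the
   composition factors are the quotients H / K for consecutive pairs (H, K)
   of G :: s, whose order is the index #|H : K|%g. *)
Definition p_solvable (p : nat) (gT : finGroupType) (G : {group gT}) : Prop :=
  forall s : seq {group gT}, jordanholder.comps G s ->
    path (fun H K : {group gT} => (#|H : K|%g == p) || ~~ (p %| #|H : K|%g))%N G s.

(* A square matrix over F is semisimple if it becomes diagonalizable over some
   extension field of F (equivalently, over an algebraic closure of F). *)
Definition mx_semisimple (F : fieldType) (n : nat) (A : 'M[F]_n) : Prop :=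
  exists (L : fieldType) (f : {rmorphism F -> L}), diagonalizable (map_mx f A).

Definition semisimple_elts (F : fieldType) (gT : finGroupType) (G : {group gT})
  (n : nat) (rG : mx_representation F G n) : {set gT} :=
  [set x in G | `[< mx_semisimple (rG x) >]].

Definition weakly_adequate (F : fieldType) (gT : finGroupType) (G : {group gT})
  (n : nat) (rG : mx_representation F G n) : Prop :=
  row_full (\sum_(x in semisimple_elts rG) <<mxvec (rG x)>>)%MS.

(* Main.v *)
Require Import Defs.
From HB Require Import structures.
From mathcomp Require Import all_boot all_order all_algebra all_fingroup all_solvable all_field all_character.
From mathcomp Require Import boolp.

(* Let H be a Hall p'-subgroup of G. All elements of H act semisimply, so it
   suffices that V restricted to H is absolutely irreducible. Over a splitting
   field, Hom_H(V, W) = Hom_G(V, W) for all irreducible V, W of degree prime to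
   p, by induction along a subnormal series with factors p- or p'-groups. Let M
   be the first term. By Clifford's theorem V and W restricted to M are sums of
   irreducibles of degree prime to p, so Hom_(H :&: M)(V, W) = Hom_M(V, W) by
   induction. If G / M is a p'-group then G = M H and we are done. If G / M is a
   p-group, it acts on the trace-zero part of End_M(V), whose fixed points are
   scalars of trace zero, hence zero because p does not divide dim V; a p-group
   acting in characteristic p without nonzero fixed points acts on the zero
   space, so End_M(V) consists of scalars. Likewise Hom_M(V, W) != 0 yields a
   G-isomorphism V -> W, which reduces Hom_M(V, W) to End_M(V).
   Taking V = W, End_H(V) is scalar and Maschke's theorem concludes. *)

Set Implicit Arguments. Unset Strict Implicit. Unset Printing Implicit Defensive.
Import GroupScope GRing.Theory.

(** * Hall p'-subgroups of p-solvable groups: existence and conjugacy *)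

Section PComplements.

Variables (p : nat) (gT : finGroupType).
Implicit Types (G H K M : {group gT}) (s : seq {group gT}).

(** [G] stays outside the list so that the tail of a series is a series of its first term, as the
    inductions require. *)
Definition p_p'_series G s :=
  (last G s == 1%G) &&
  path [rel H K : {group gT} |
         (K <| H) && (p.-nat #|H : K| || p^'.-nat #|H : K|)] G s.

Lemma p_solvable_series G :
  prime p -> p_solvable p G -> exists s, p_p'_series G s.
Proof.
move=> pr_p solG; have [s compGs] := exists_comps G; exists s.
have /andP[lastGs compG] := compGs; rewrite /p_p'_series lastGs /=.
have := solG s compGs.
elim: s G compG {solG compGs lastGs} => //= M s IHs G /andP[maxM compM] /andP[ixM pathM].
rewrite (maxnormal_normal maxM) (IHs M) ?andbT //=.
case/orP: ixM => [/eqP->|]; first by rewrite pnat_id.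
by rewrite p'natE // => ->; rewrite orbT.
Qed.

(** The image of [H] in [G / M] is both a p-group and a p'-group. *)
Lemma p'Hall_sub_index_p G M H :
  M <| G -> p.-nat #|G : M| -> p^'.-Hall(G) H -> H \subset M.
Proof.
move=> /andP[_ nMG] pGM hallH; have sHG := pHall_sub hallH.
have nMH := subset_trans sHG nMG.
rewrite -quotient_sub1 // subG1 trivg_card1; apply/eqP.
apply: (@pnat_1 p); last exact: quotient_pgroup (pHall_pgroup hallH).
by apply: (pnat_dvd (cardSg (quotientS M sHG))); rewrite card_quotient.
Qed.

Lemma p'Hall_index_p G M H :
  M \subset G -> p.-nat #|G : M| -> p^'.-Hall(M) H -> p^'.-Hall(G) H.
Proof.
move=> sMG pGM hallH; rewrite pHallE (subset_trans (pHall_sub hallH)) //=.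
rewrite (card_Hall hallH) -(Lagrange sMG) partnM // (@part_p'nat p^' #|G : M|) ?muln1 //.
by rewrite pnatNK.
Qed.

(** The index of [M * H] divides both the pi-number [#|G : M|] and the pi'-number [#|G : H|]. *)
Lemma Hall_mul_normal (pi : nat_pred) G M H :
  M <| G -> pi.-nat #|G : M| -> pi.-Hall(G) H -> M * H = G.
Proof.
move=> nsMG piGM hallH; have [sMG nMG] := andP nsMG.
have sHG := pHall_sub hallH; have nMH := subset_trans sHG nMG.
have defMH: M <*> H = M * H by rewrite norm_joinEr.
have sMHG: M <*> H \subset G by rewrite join_subG sMG.
rewrite -defMH; apply/eqP; rewrite eqEsubset sMHG -indexg_eq1 /=; apply/eqP.
apply: (@pnat_1 pi); first exact: pnat_dvd (indexgS G (joing_subl M H)) piGM.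
by have [_ _] := and3P hallH; apply: pnat_dvd; apply: indexgS (joing_subr M H).
Qed.

(** Both subgroups normalise their common intersection [K] with [M]. Modulo [K], the normaliser of
    [K] in [M] is a p-group, hence solvable, and the conjugacy part of Schur-Zassenhaus applies. *)
Lemma p'Hall_conj_same_meet G M H1 H2 :
    M <| G -> p^'.-nat #|G : M| -> p^'.-Hall(G) H1 -> p^'.-Hall(G) H2 ->
    H1 :&: M = H2 :&: M ->
  exists2 x, x \in M & H2 :=: H1 :^ x.
Proof.
move=> nsMG p'GM hallH1 hallH2 eqK; have [sMG nMG] := andP nsMG.
pose K := (H1 :&: M)%G.
have hallK : p^'.-Hall(M) K by apply: Hall_setI_normal hallH1.
pose N := 'N_G(K)%G; pose NM := (M :&: N)%G.
have sKM := pHall_sub hallK.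
have nKH H : p^'.-Hall(G) H -> H :&: M = K -> H \subset 'N(K).
  by move=> hallH <-; rewrite normsI ?normG // (subset_trans (pHall_sub hallH)).
have [nKH1 nKH2] := (nKH H1 hallH1 erefl, nKH H2 hallH2 (esym eqK)).
have sKNM : K \subset NM by rewrite !subsetI sKM normG (subset_trans sKM).
have nsKNM : K <| NM.
  by rewrite /normal sKNM (subset_trans (subsetIr M N)) ?subsetIr.
have pNMK : p.-group (NM / K).
  rewrite /pgroup card_quotient ?normal_norm //.
  have [_ _] := and3P hallK; rewrite pnatNK; apply: pnat_dvd.
  exact: indexSg (subsetIl _ _).
have sH1N : H1 \subset N by rewrite subsetI (pHall_sub hallH1).
have nNMH1 : H1 \subset 'N(NM).
  by rewrite normsI ?(normsG sH1N) // (subset_trans (pHall_sub hallH1)).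
(* Dedekind's law: [M * H1 = G] and [H1 \subset N] give [NM * H1 = N], which contains [H2]. *)
have sH2 : H2 / K \subset NM / K * (H1 / K).
  rewrite -quotientMl ?normal_norm // quotientS //.
  rewrite /= -/N setIC group_modr //.
  rewrite (Hall_mul_normal nsMG p'GM hallH1) !subsetI nKH2.
  by rewrite (pHall_sub hallH2).
have sKH1 : K \subset H1 := subsetIl _ _.
have sKH2 : K \subset H2 by rewrite /K /= eqK subsetIl.
have p'quo H : p^'.-Hall(G) H -> p^'.-group (H / K).
  by move/pHall_pgroup; apply: quotient_pgroup.
have [|||xb] := SchurZassenhaus_trans_sol (pgroup_sol pNMK) _ sH2.
- exact: quotient_norms.
- exact: pnat_coprime pNMK (p'quo _ hallH1).
- rewrite !card_quotient // -!divgS ?sKH1 ?sKH2 //.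
  by rewrite (card_Hall hallH1) (card_Hall hallH2).
case/morphimP=> x nKx NMx -> {xb}; rewrite -quotientJ // => eqH2.
have Mx : x \in M by case/setIP: NMx.
exists x => //; apply: (@quotient_inj _ K H2 (H1 :^ x)%G) eqH2.
  by rewrite /normal sKH2.
rewrite /normal -{1}(normP nKx) conjSg sKH1 /=.
by rewrite -{1}(normP nKx) normJ conjSg.
Qed.

(** Existence and conjugacy go together: over a p'-factor, existence in [G] rests on a Frattini
    argument, hence on conjugacy in [M]. *)
Lemma p'Hall_exists_conj G s :
    p_p'_series G s ->
  (exists H, p^'.-Hall(G) H) /\
  (forall H1 H2, p^'.-Hall(G) H1 -> p^'.-Hall(G) H2 ->
     exists2 x, x \in G & H2 :=: H1 :^ x).
Proof.
elim: s G => [|M s IHs] G /andP[/= /eqP lastG].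
  move=> _; rewrite lastG; split=> [|H1 H2 /pHall_sub/trivgP-> /pHall_sub/trivgP->].
    by exists 1%G; rewrite pHallE subxx cards1 part_p'nat.
  by exists 1; rewrite ?conjs1g.
case/andP=> /andP[nsMG ixM] serM; have [sMG nMG] := andP nsMG.
have [|[K hallK] conjM] := IHs M; first by rewrite /p_p'_series lastG eqxx.
case/orP: ixM => [pGM | p'GM].
  split=> [|H1 H2 hallH1 hallH2]; first by exists K; apply: p'Hall_index_p hallK.
  have [||x Mx defH2] := conjM H1 H2; last by exists x => //; apply: (subsetP sMG).
    apply: (pHall_subl _ sMG hallH1); exact: p'Hall_sub_index_p hallH1.
  apply: (pHall_subl _ sMG hallH2); exact: p'Hall_sub_index_p hallH2.
have sKM := pHall_sub hallK; have sKG := subset_trans sKM sMG.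
pose N := 'N_G(K)%G; pose NM := (M :&: N)%G.
have sNG: N \subset G := subsetIl _ _.
have sKN: K \subset N by rewrite subsetI sKG normG.
have nsKN: K <| N by rewrite /normal sKN subsetIr.
have nKN := normal_norm nsKN.
have sKNM: K \subset NM by rewrite subsetI sKM.
have sNMN: NM \subset N := subsetIr _ _.
have nsKNM: K <| NM := normalS sKNM sNMN nsKN.
have nsNMN: NM <| N by rewrite /NM /= setIC; apply: normalGI nsMG.
have defG: M * N = G. (* Frattini argument *)
  apply/eqP; rewrite eqEsubset mul_subG //=; apply/subsetP=> g Gg.
  have [|m Mm defKg] := conjM K (K :^ g^-1)%G hallK.
    by rewrite pHallJnorm // groupV (subsetP nMG).
  rewrite -(mulKg m g); apply: mem_mulg; first by rewrite groupV.
  rewrite in_setI groupM ?(subsetP sMG m) //=; apply/normP.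
  by rewrite conjsgM -defKg -conjsgM mulVg conjsg1.
have iNM : #|N : NM| = #|G : M|.
  by rewrite -[in RHS]defG indexMg /= (setIC M) indexgI.
have pNMK : p.-group (NM / K).
  rewrite /pgroup card_quotient ?normal_norm //.
  have [_ _] := and3P hallK; rewrite pnatNK; apply: pnat_dvd.
  exact: indexSg (subsetIl _ _).
split=> [|H1 H2 hallH1 hallH2].
  have hallNM : p.-Hall(N / K) (NM / K).
    rewrite /pHall quotientS //= pNMK.
    by rewrite /= index_quotient_eq ?iNM // subIset // sKNM orbT.
  (* [Lb] complements the normal Hall p-subgroup [NM / K], so its preimage [L] has order
     [#|K| * #|G : M|], the p'-part of [#|G|]. *)
  have /splitsP[Lb /complP[tiLb defLb]] :=
    SchurZassenhaus_split (pHall_Hall hallNM) (quotient_normal K nsNMN).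
  have sLbN: Lb \subset N / K by rewrite -defLb mulG_subr.
  have [L defL sKL sLN] := inv_quotientS nsKN sLbN.
  exists L; rewrite pHallE (subset_trans sLN) //=; apply/eqP.
  have oLb: #|Lb| = #|G : M|.
    rewrite -iNM -(index_quotient_eq _ sNMN nKN); last first.
      by rewrite (subset_trans _ sKNM) ?subsetIr.
    by rewrite -defLb indexMg -divgI setIC tiLb cards1 divn1.
  rewrite -(Lagrange sKL) -(Lagrange sMG) partnM // (part_pnat_id p'GM).
  by rewrite -card_quotient ?(subset_trans sLN) // -defL oLb (card_Hall hallK).
have defM H : p^'.-Hall(G) H -> p^'.-Hall(M) (H :&: M).
  exact: Hall_setI_normal.
(* Conjugating by [m] makes the intersections with [M] equal, as [p'Hall_conj_same_meet]
   requires. *)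
have [m Mm defK2] := conjM _ _ (defM _ hallH1) (defM _ hallH2).
have Gm := subsetP sMG m Mm.
have [||x Mx ->] := @p'Hall_conj_same_meet G M (H1 :^ m)%G H2 nsMG p'GM _ hallH2.
- by rewrite pHallJ.
- by rewrite defK2 conjIg (conjGid Mm).
by exists (m * x); rewrite ?groupM ?(subsetP sMG x) // conjsgM.
Qed.

End PComplements.

(** * Intertwining matrices, Schur's lemma and averaging by conjugation *)

Local Open Scope ring_scope.

(** Matrices act on row vectors, so this is Hom_S(V, W); a free [S] allows comparing subgroups of
    [G] without restricting the representations. *)
Definition intertwines (F : fieldType) (gT : finGroupType) (G : {group gT})
    (n m : nat) (rV : mx_representation F G n) (rW : mx_representation F G m)
    (S : {set gT}) (A : 'M[F]_(n, m)) :=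
  forall x, x \in S -> rV x *m A = A *m rW x.

Section Intertwiners.

Variables (F : fieldType) (gT : finGroupType) (G : {group gT}).

Section TwoReps.

Variables (n m : nat).
Variables (rV : mx_representation F G n) (rW : mx_representation F G m).
Implicit Types (A B : 'M[F]_(n, m)) (H K M P : {group gT}).

Lemma intertwinesM H K A :
    H \subset G -> K \subset G ->
  intertwines rV rW H A -> intertwines rV rW K A ->
  intertwines rV rW (H * K)%g A.
Proof.
move=> sHG sKG homH homK _ /mulsgP[x y Hx Ky ->].
have [Gx Gy] := (subsetP sHG x Hx, subsetP sKG y Ky).
by rewrite !repr_mxM // -mulmxA homK // mulmxA homH // mulmxA.
Qed.

(** Schur's lemma: the kernel and the row space of [B] are submodules. *)
Lemma intertwines_rank_inv B :
    mx_irreducible rV -> mx_irreducible rW -> intertwines rV rW G B -> B != 0 ->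
  row_free B /\ row_full B.
Proof.
move=> /mx_irrP[n_gt0 irrV] /mx_irrP[m_gt0 irrW] homB nzB; split.
  rewrite -kermx_eq0; apply: contraR nzB => nz_ker.
  have modK : mxmodule rV (kermx B).
    apply/mxmoduleP=> x Gx; apply/sub_kermxP.
    by rewrite -mulmxA homB // mulmxA mulmx_ker mul0mx.
  have full := irrV _ modK nz_ker.
  by rewrite -[B]mul1mx; apply/eqP/sub_kermxP; rewrite sub1mx.
have modB : mxmodule rW <<B>>%MS.
  apply/mxmoduleP=> x Gx; rewrite !genmxE (eqmxMr _ (genmxE _)).
  by rewrite -homB // submxMl.
have := irrW _ modB; rewrite -!mxrank_eq0 !genmxE mxrank_eq0 => /(_ nzB).
by rewrite /row_full !genmxE.
Qed.

(** The conjugation action on Hom(V, W), with matrices flattened by [mxvec]; its fixed points are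
    the intertwiners. *)
Definition conj_mx (x : gT) : 'M[F]_(n * m) :=
  lin_mx (mulmxr (rW x) \o mulmx (rV x^-1%g)).

Lemma mul_conj_mx x A : mxvec A *m conj_mx x = mxvec (rV x^-1%g *m A *m rW x).
Proof. by rewrite mul_vec_lin. Qed.

Lemma conj_mx_repr : mx_repr G conj_mx.
Proof.
split=> [|x y Gx Gy]; apply/row_matrixP=> i; rewrite !rowE.
  by rewrite -[delta_mx _ _]vec_mxK mul_conj_mx invg1 !repr_mx1 mul1mx !mulmx1.
rewrite -[delta_mx _ _]vec_mxK mulmxA !mul_conj_mx invMg.
by rewrite !repr_mxM ?groupV // !mulmxA.
Qed.

Definition conj_repr := MxRepresentation conj_mx_repr.

(* P acts by conjugation on the nonzero span of the G-conjugates of A, and a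
   p-group acting in characteristic p fixes a nonzero vector. *)
Lemma intertwiner_average p M P A :
    p \in [pchar F] -> p.-group P -> M <| G -> P \subset G -> (M * P)%g = G ->
    intertwines rV rW M A -> A != 0 ->
  exists a : gT -> F,
    let B := \sum_(x in G) a x *: (rV x^-1%g *m A *m rW x) in
    B != 0 /\ intertwines rV rW G B.
Proof.
move=> charFp pP nsMG sPG defG homA nzA; have [sMG nMG] := andP nsMG.
pose U := cyclic_mx conj_repr (mxvec A).
have modU : mxmodule conj_repr U := cyclic_mx_module _ _.
have rU_gt0 : (0 < \rank U)%N.
  rewrite lt0n mxrank_eq0; apply: contraNneq nzA => U0.
  by have := cyclic_mx_id conj_repr (mxvec A); rewrite -/U U0 submx0 mxvec_eq0.
have := rfix_pgroup_pchar charFp (submod_repr modU) rU_gt0 pP sPG.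
case/rowV0Pn=> w /rfix_mxP fixw nzw.
pose v := val_submod w.
have sVU : (v <= U)%MS := val_submodP w.
have nzv : v != 0 by rewrite val_submod_eq0.
have fixv x : x \in P -> v *m conj_mx x = v.
  move=> Px; have Gx := subsetP sPG x Px.
  by rewrite -[LHS](val_submodJ modU) // fixw.
(* The fixed vector is a combination of conjugates of [A]; the coefficients stay explicit so that
   its trace can be computed from that of [A]. *)
have /cyclic_mxP[C /envelop_mxP[a defC] defv] := sVU.
exists a => B.
have defB : mxvec B = v.
  rewrite defv defC mulmx_sumr linear_sum; apply: eq_bigr => x Gx.
  by rewrite -scalemxAr linearZ mul_conj_mx.
split; first by rewrite -mxvec_eq0 defB.
(* On [M], each conjugate of [A] intertwines because [M] is normal; on [P], [B] is a fixed point. *)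
rewrite -defG; apply: intertwinesM => // [y My | y Py].
  have Gy := subsetP sMG y My.
  rewrite /B mulmx_suml mulmx_sumr; apply: eq_bigr => x Gx.
  rewrite -scalemxAl -scalemxAr; congr (_ *: _).
  have Mxy : (y ^ x^-1 \in M)%g by rewrite memJ_norm // groupV (subsetP nMG).
  have Gxy := subsetP sMG _ Mxy.
  have -> : rV y *m (rV x^-1%g *m A *m rW x) =
            rV x^-1%g *m (rV (y ^ x^-1)%g *m A) *m rW x.
    by rewrite !mulmxA -!repr_mxM ?groupV // conjgE invgK !mulgA mulVg mul1g.
  rewrite homA // -!mulmxA -!repr_mxM //.
  by rewrite conjgE invgK !mulgA mulgKV.
have Gy := subsetP sPG y Py.
have eqB : rV y^-1%g *m B *m rW y = B.
  by apply: (can_inj mxvecK); rewrite -mul_conj_mx defB fixv.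
by rewrite -[in LHS]eqB !mulmxA -repr_mxM ?groupV // mulgV repr_mx1 mul1mx.
Qed.

End TwoReps.
End Intertwiners.

(** * Passing from a normal subgroup of p-power index to the whole group *)

Section PIndex.

Variables (F : fieldType) (p : nat) (gT : finGroupType) (G M P : {group gT}).
Hypotheses (charFp : p \in [pchar F]) (pP : p.-group P).
Hypotheses (nsMG : M <| G) (sPG : P \subset G) (defG : (M * P)%g = G).

(* If A - tr(A)/n had a nonzero average, that average would be a scalar of trace
   zero. *)
Lemma cent_normal_scalar n (rV : mx_representation F G n) (A : 'M_n) :
    mx_absolutely_irreducible rV -> ~~ (p %| n)%N ->
  intertwines rV rV M A -> is_scalar_mx A.
Proof.
move=> absV; rewrite (dvdn_pcharf charFp) => nz_n homA.
pose a := \tr A / n%:R; pose A0 := A - a%:M.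
have trA0 : \tr A0 = 0.
  by rewrite linearB /= mxtrace_scalar -mulr_natr divfK ?subrr.
have homA0 : intertwines rV rV M A0.
  by move=> x Mx; rewrite mulmxBl mulmxBr homA // scalar_mxC.
have [A0_eq0 | nzA0] := eqVneq A0 0.
  by rewrite -[A](subrK a%:M) -/A0 A0_eq0 add0r scalar_mx_is_scalar.
have [b [/= nzB homB]] := intertwiner_average charFp pP nsMG sPG defG homA0 nzA0.
case/negP: nzB; set B := \sum_(x in G) _ in homB *.
have trB : \tr B = 0.
  rewrite linear_sum big1 //= => x Gx.
  by rewrite linearZ /= -mulmxA mxtrace_mulC repr_mxK // trA0 mulr0.
have /is_scalar_mxP[c defB] : is_scalar_mx B.
  apply: (mx_abs_irr_cent_scalar absV); apply/centgmxP=> x Gx.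
  by rewrite homB.
move: trB; rewrite defB mxtrace_scalar -mulr_natr => /eqP.
by rewrite mulf_eq0 (negPf nz_n) orbF => /eqP->; rewrite raddf0 eqxx.
Qed.

(** A nonzero average [B] of [A] has inverse [pinvmx B] by Schur's lemma. Then [A *m pinvmx B]
    commutes with [M] on V, so it is scalar and [A] is a multiple of [B]. *)
Lemma intertwines_index_p n m (rV : mx_representation F G n)
    (rW : mx_representation F G m) (A : 'M_(n, m)) :
    mx_absolutely_irreducible rV -> mx_irreducible rW -> ~~ (p %| n)%N ->
  intertwines rV rW M A -> intertwines rV rW G A.
Proof.
move=> absV irrW p'n homA; have [-> | nzA] := eqVneq A 0.
  by move=> x _; rewrite mulmx0 mul0mx.
have [b []] /= := intertwiner_average charFp pP nsMG sPG defG homA nzA.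
move: (\sum_(x in G) _) => B nzB homB.
have [freeB fullB] := intertwines_rank_inv (mx_abs_irrW absV) irrW homB nzB.
have homBV x : x \in G -> pinvmx B *m rV x = rW x *m pinvmx B.
  move=> Gx; rewrite -[LHS]mulmx1 -(mulmxVp freeB) mulmxA -(mulmxA _ (rV x)).
  rewrite homB // (mulmxA (pinvmx B) B).
  by rewrite mulVpmx // mul1mx.
have /is_scalar_mxP[c defC] : is_scalar_mx (A *m pinvmx B).
  apply: (cent_normal_scalar absV p'n) => x Mx.
  have Gx := subsetP (normal_sub nsMG) x Mx.
  by rewrite mulmxA homA // -(mulmxA A (rW x)) -homBV // (mulmxA A).
have -> : A = c *: B.
  by rewrite -mul_scalar_mx -defC -mulmxA mulVpmx // mulmx1.
by move=> x Gx; rewrite -scalemxAr -scalemxAl homB.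
Qed.

End PIndex.

(** * Clifford theory: reducing intertwiners to simple constituents *)

Section Clifford.

Variables (F : fieldType) (gT : finGroupType) (G M : {group gT}).
Hypothesis nsMG : M <| G.
Let sMG := normal_sub nsMG.

(** The summands are [G]-translates of one simple submodule, so they share one rank, which divides
    [n]. *)
Lemma Clifford_decomposition n (rV : mx_representation F G n) :
    mx_irreducible rV ->
  exists (X : {set gT}) (S : gT -> 'M[F]_n),
  [/\ forall x, x \in X -> mxsimple (subg_repr rV sMG) (S x),
      forall x, x \in X -> (\rank (S x) %| n)%N,
      (\sum_(x in X) S x :=: 1%:M)%MS
    & mxdirect (\sum_(x in X) S x)].
Proof.
(* With a boolean goal, the simple submodule [T], obtained under [classically], may be used. *)
move=> irrV; have /mx_irrP[n_gt0 _] := irrV; apply/asboolP.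
apply: (mxsimple_exists (mxmodule1 (subg_repr rV sMG))) => [|[T simT _]].
  by rewrite -mxrank_eq0 mxrank1 -lt0n.
have [X sXG [/= defX dxX]] := Clifford_basis irrV simT.
have GX x : x \in X -> x \in G by apply: subsetP.
have rT x : x \in X -> \rank (T *m rV x) = \rank T.
  by move=> Xx; rewrite mxrankMfree // repr_mx_free ?GX.
apply/asboolP; exists X, (fun x => T *m rV x); split=> // x Xx.
  by apply: Clifford_simple => //; apply: GX.
rewrite -[X in (_ %| X)%N](mxrank1 F) -defX (mxdirectP dxX) /= rT //.
by rewrite (eq_bigr _ rT) sum_nat_const dvdn_mull.
Qed.

(** In bases of [S] and [T], the restriction of [A] to [S] is a matrix [A'] between the submodule
    representations; the hypothesis on these applies to [A'] and is carried back by [val_submod]. *)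
Lemma intertwines_simple_block (K : {group gT}) n m
    (rV : mx_representation F G n) (rW : mx_representation F G m)
    (S : 'M_n) (T : 'M_m) (modS : mxmodule (subg_repr rV sMG) S)
    (modT : mxmodule (subg_repr rW sMG) T) (A : 'M_(n, m)) :
    K \subset M ->
    (forall A', intertwines (submod_repr modS) (submod_repr modT) K A' ->
                intertwines (submod_repr modS) (submod_repr modT) M A') ->
    (A <= T)%MS -> intertwines rV rW K A ->
  forall x, x \in M -> S *m (rV x *m A) = S *m (A *m rW x).
Proof.
move=> sKM homKM sAT homA x Mx.
pose A' := in_submod T (val_submod (U:=S) 1%:M *m A).
have sAT' k (B : 'M_(k, n)) : (B *m A <= T)%MS by rewrite mulmx_sub.
have valA' : val_submod A' = val_submod (U:=S) 1%:M *m A.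
  by rewrite in_submodK.
have valM (B : 'M_(\rank S)) : val_submod (B *m A') = val_submod B *m A.
  by rewrite [LHS]val_submodE -mulmxA -val_submodE valA' mulmxA -val_submodE.
have valJ y : y \in M ->
    val_submod (submod_repr modS y *m A') = val_submod (U:=S) 1%:M *m (rV y *m A).
  move=> My; rewrite valM -[submod_repr modS y]mul1mx.
  by rewrite (val_submodJ modS) // mulmxA.
have valJ' y : y \in M ->
    val_submod (A' *m submod_repr modT y) = val_submod (U:=S) 1%:M *m (A *m rW y).
  by move=> My; rewrite (val_submodJ modT) // valA' mulmxA.
have homA' : intertwines (submod_repr modS) (submod_repr modT) K A'.
  move=> y Ky; have My := subsetP sKM y Ky.
  by apply: val_submod_inj; rewrite valJ // valJ' // homA.
have eqx : val_submod (U:=S) 1%:M *m (rV x *m A)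
           = val_submod (U:=S) 1%:M *m (A *m rW x).
  by rewrite -valJ // -valJ' // homKM.
have /submxP[E defS] : (S <= val_submod (U:=S) 1%:M)%MS by rewrite val_submod1.
by rewrite defS -(mulmxA E) eqx mulmxA.
Qed.

(** [A] is cut into blocks between simple [M]-constituents of V and W. Their degrees divide those of
    V and W, hence inherit [q]. *)
Lemma intertwines_normal_restrict (q : nat -> bool) (K : {group gT}) :
    K \subset M -> (forall d n, (d %| n)%N -> q n -> q d) ->
    (forall n m (rS : mx_representation F M n) (rT : mx_representation F M m) A,
       mx_irreducible rS -> mx_irreducible rT -> q n -> q m ->
       intertwines rS rT K A -> intertwines rS rT M A) ->
  forall n m (rV : mx_representation F G n) (rW : mx_representation F G m) A,
    mx_irreducible rV -> mx_irreducible rW -> q n -> q m ->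
  intertwines rV rW K A -> intertwines rV rW M A.
Proof.
move=> sKM q_dvd homKM n m rV rW A irrV irrW qn qm homA x Mx.
have [X [S [simS rS defV _]]] := Clifford_decomposition irrV.
have [Y [T [simT rT defW dxY]]] := Clifford_decomposition irrW.
pose T' y := (\sum_(z in Y | z != y) T z)%MS.
have dxT y : y \in Y -> (T y :&: T' y = 0)%MS by apply: mxdirect_sumsP.
(* The projections [Q y] commute with [M], and a matrix killed by all of them vanishes, so each
   block can be tested separately. *)
pose Q y := proj_mx (T y) (T' y).
have homQ y : y \in Y -> intertwines rW rW M (Q y).
  move=> Yy z Mz; have modT' : mxmodule (subg_repr rW sMG) (T' y).
    by apply: sumsmx_module => t /andP[Yt _]; have [] := simT t Yt.
  have [modT _ _] := simT y Yy.
  have := proj_mx_hom (dxT y Yy) modT modT'.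
  have full : (1%:M <= T y + T' y)%MS by rewrite -defW (bigD1 y Yy).
  by move/(submx_trans full)/hom_mxP/(_ z Mz); rewrite /= !mul1mx.
have Q0 k (B : 'M_(k, m)) : (forall y, y \in Y -> B *m Q y = 0) -> B = 0.
  move=> BQ0; have /sub_sumsmxP[u defB] : (B <= \sum_(y in Y) T y)%MS.
    by rewrite defW submx1.
  rewrite defB big1 // => y Yy; rewrite -[RHS](BQ0 y Yy) defB (bigD1 y Yy) /=.
  rewrite mulmxDl proj_mx_id ?submxMl ?dxT // proj_mx_0 ?addr0 ?dxT //.
  rewrite summx_sub // => z Yz; rewrite (submx_trans (submxMl _ _)) //.
  exact: (sumsmx_sup z).
apply/eqP; rewrite -subr_eq0; set D := _ - _.
suffices: (\sum_(s in X) S s <= kermx D)%MS.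
  by rewrite defV => /sub_kermxP; rewrite mul1mx => ->.
apply/sumsmx_subP=> s Xs; apply/sub_kermxP/Q0 => y Yy.
have [modS _ _] := simS s Xs; have [modT _ _] := simT y Yy.
have sQT : (Q y <= T y)%MS by rewrite -[Q y]mul1mx proj_mx_sub.
move: (Q y) (homQ y Yy) sQT => R homR sRT.
rewrite -mulmxA mulmxBl mulmxBr -(mulmxA A) homR // -mulmxA (mulmxA A R).
apply/eqP; rewrite subr_eq0; apply/eqP.
apply: (intertwines_simple_block (modS := modS) (modT := modT) sKM _ _ _ Mx).
- move=> A'; apply: homKM.
  + by apply/submod_mx_irr; apply: simS.
  + by apply/submod_mx_irr; apply: simT.
  + exact: q_dvd (rS s Xs) qn.
  exact: q_dvd (rT y Yy) qm.
- exact: mulmx_sub.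
by move=> z Kz; rewrite mulmxA homA // -!mulmxA homR // (subsetP sKM).
Qed.

End Clifford.

(** * Restriction to a Hall p'-subgroup and weak adequacy *)

Lemma p'Hall_intertwines (F : fieldType) (p : nat) (gT : finGroupType)
    (s : seq {group gT}) (G H : {group gT}) :
    p \in [pchar F] -> group_closure_field F gT ->
    p_p'_series p G s -> p^'.-Hall(G) H ->
  forall n m (rV : mx_representation F G n) (rW : mx_representation F G m) A,
    mx_irreducible rV -> mx_irreducible rW -> ~~ (p %| n)%N -> ~~ (p %| m)%N ->
  intertwines rV rW H A -> intertwines rV rW G A.
Proof.
move=> charFp splitF; elim: s G H => [|M s IHs] G H /andP[/= /eqP lastG].
  move=> _ _ n m rV rW A _ _ _ _ _ x Gx.
  have /set1P-> : x \in (1%G : {group gT}) by rewrite -lastG.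
  by rewrite !repr_mx1 mul1mx mulmx1.
case/andP=> /andP[nsMG ixM] serM hallH n m rV rW A irrV irrW p'n p'm homA.
have sHG := pHall_sub hallH; have sMG := normal_sub nsMG.
have hallHM : p^'.-Hall(M) (H :&: M)%G := Hall_setI_normal nsMG hallH.
have homM : intertwines rV rW M A.
  apply: (@intertwines_normal_restrict _ _ G M nsMG (fun d => ~~ (p %| d)%N)
            (H :&: M)%G) => //.
  - exact: subsetIr.
  - by move=> d k dvd_dk; apply: contra => /dvdn_trans->.
  - by apply: IHs => //; rewrite /p_p'_series lastG eqxx.
  by move=> x /setIP[Hx _]; apply: homA.
case/orP: ixM => [pGM | p'GM]; last first.
  by rewrite -(Hall_mul_normal nsMG p'GM hallH); apply: intertwinesM.
(* A Sylow p-subgroup covers the p-group [G / M] and serves as the p-group acting in the averaging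
   argument. *)
have [P sylP] := Sylow_exists p G.
apply: (intertwines_index_p charFp (pHall_pgroup sylP) nsMG (pHall_sub sylP)) => //.
  exact: Hall_mul_normal sylP.
exact: splitF.
Qed.

(** By Maschke, a nonzero submodule is the image of an [H]-equivariant projection; this is a nonzero
    scalar, so the submodule is everything. *)
Lemma p'group_scalar_cent_abs_irr (F : fieldType) (gT : finGroupType)
    (H : {group gT}) n (rH : mx_representation F H n) :
    (0 < n)%N -> [pchar F]^'.-group H ->
    (forall A, centgmx rH A -> is_scalar_mx A) ->
  mx_absolutely_irreducible rH.
Proof.
move=> n_gt0 F'H scalH; apply: cent_mx_scalar_abs_irr; last first.
  rewrite leqNgt; apply/(has_non_scalar_mxP (scalar_mx_cent _ _)) => -[A].
  by rewrite memmx_cent_envelop => /scalH->.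
apply/mx_irrP; split=> // U modU nzU.
have [W modW defUW dxUW] := mx_Maschke_pchar rH F'H modU (submx1 U).
have tiUW := mxdirect_addsP dxUW.
have full : (1%:M <= U + W)%MS by rewrite defUW.
have /is_scalar_mxP[a defP] : is_scalar_mx (proj_mx U W).
  apply: scalH; apply/centgmxP=> x Hx.
  have /(submx_trans full)/hom_mxP/(_ x Hx) := proj_mx_hom tiUW modU modW.
  by rewrite !mul1mx.
have nza : a != 0.
  apply: contraNneq nzU => a0; rewrite -(proj_mx_id tiUW (submx_refl U)) defP a0.
  by rewrite raddf0 mulmx0.
rewrite -sub1mx; have := proj_mx_sub U W (1%:M : 'M_n).
by rewrite defP mul1mx -(scalemx1 n a) eqmx_scale.
Qed.

(** A splitting field of [<[x]>] contains a primitive root of unity of order [#[x]], so X^#[x] - 1,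
    which annihilates [rG x], splits there with distinct roots. *)
Lemma p'_elt_semisimple (F : fieldType) (p : nat) (gT : finGroupType)
    (G : {group gT}) n (rG : mx_representation F G n) x :
  p \in [pchar F] -> x \in G -> p^'.-elt x -> mx_semisimple (rG x).
Proof.
move=> charFp Gx p'x; apply/asboolP.
apply: (@group_splitting_field_exists _ <[x]>%G F) => -[L f splitL].
have charLp : p \in [pchar L] by rewrite (fmorph_pchar f).
have L'x : [pchar L]^'.-group <[x]>.
  by rewrite (eq_pgroup _ (eq_negn (pcharf_eq charLp))).
apply: (splitting_cyclic_primitive_root_pchar (cycle_cyclic x) L'x splitL).
case=> z prim_z; apply/asboolP; exists L, f.
case: n rG => [|n] rG.
  have -> : map_mx f (rG x) = 0 by apply/matrixP=> -[].
  exact: diagonalizable0.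
apply/diagonalizableP; exists [seq z ^+ i | i <- index_iota 0 #[x]].
  rewrite map_inj_in_uniq ?iota_uniq // => i j.
  rewrite !mem_index_iota /= => lt_i lt_j /eqP.
  by rewrite (eq_prim_root_expr prim_z) !modn_small // => /eqP.
rewrite big_map (factor_Xn_sub_1 prim_z); apply: mxminpoly_min.
rewrite rmorphB rmorphXn /= horner_mx_C horner_mx_X -rmorphXn -repr_mxX //=.
by rewrite expg_order repr_mx1 map_mx1 subrr.
Qed.

Theorem theorem1p2 (p : nat) (F : fieldType) (gT : finGroupType) (G : {group gT})
    (n : nat) (rG : mx_representation F G n) :
  prime p -> p \in [pchar F]%R -> p_solvable p G ->
  mx_absolutely_irreducible rG -> ~~ (p %| n)%N ->
  weakly_adequate rG.
Proof.
move=> pr_p charFp solG absG p'n.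
have [s serG] := p_solvable_series pr_p solG.
have [[H hallH] _] := p'Hall_exists_conj serG.
have sHG := pHall_sub hallH; have p'H := pHall_pgroup hallH.
pose rH := subg_repr rG sHG.
have absH : mx_absolutely_irreducible rH.
  apply: p'group_scalar_cent_abs_irr => [||A /centgmxP cHA].
  - by case/andP: absG.
  - by rewrite (eq_pgroup _ (eq_negn (pcharf_eq charFp))).
  (* [A] is moved to a splitting field [L], where absolute irreducibility keeps V irreducible;
     commutation descends to [F] because [f] is injective. *)
  apply: (@group_closure_field_exists gT F) => -[L f splitL].
  have charLp : p \in [pchar L] by rewrite (fmorph_pchar f).
  have irrL : mx_irreducible (map_repr f rG).
    by apply: mx_abs_irrW; rewrite map_mx_abs_irr.
  have homL := p'Hall_intertwines charLp splitL serG hallH irrL irrL p'n p'n.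
  apply: (mx_abs_irr_cent_scalar absG); apply/centgmxP=> x Gx.
  apply: (map_mx_inj (f := f)); rewrite !map_mxM; apply/esym/(homL (map_mx f A)) => // y Hy.
  by rewrite /= -!map_mxM; congr map_mx; apply: esym (cHA y Hy).
have /andP[_ fullH] := absH.
rewrite /weakly_adequate -sub1mx; apply: submx_trans (_ : _ <= enveloping_algebra_mx rH)%MS _.
  by rewrite sub1mx.
apply/row_subP=> i; rewrite rowK.
set h := enum_val i; have Hh : h \in H by apply: enum_valP.
apply: (sumsmx_sup h); last by rewrite genmxE.
rewrite inE (subsetP sHG h Hh) /=; apply/asboolP.
exact: p'_elt_semisimple charFp (subsetP sHG h Hh) (mem_p_elt p'H Hh).
Qed.
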